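(* Let $f:[0,1]\to\mathbb{R}$ be continuous and let $j=2k+1$ with $k\in\{0,1,2,\ldots\}$ (i.e. $j$ is a positive odd integer). Then $$\big\langle f\cdot[\![f]\!]_j\big\rangle=0 .$$
   Context: For a continuous function $g:[0,1]\to\mathbb{R}$ define its average $\langle g\rangle:=\int_0^1 g(y)\,dy$, its fluctuating part $\{g\}(y):=g(y)-\langle g\rangle$, and the function $$[\![g]\!](y):=\int_0^y\{g\}(\xi)\,d\xi-\int_0^1\int_0^\tau\{g\}(\xi)\,d\xi\,d\tau .$$ For a positive integer $j$, $[\![f]\!]_j$ denotes the result of applying the operator $[\![\cdot]\!]$ to $f$ $j$ times; e.g. $[\![f]\!]_3=[\![\,[\![\,[\![f]\!]\,]\!]\,]\!]$. *)

(* Defs.v *)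
From Stdlib Require Import Reals.
From Coquelicot Require Import Coquelicot.
Open Scope R_scope.

(* A function on [0,1] is represented by a total function R -> R whose values
   outside [0,1] are irrelevant: all integrals below run over [0,1], or over
   [0,y] with y in [0,1].  [RInt] is the Riemann integral, total by convention;
   it is meaningful here for functions continuous on [0,1]. *)

Definition unit_interval (y : R) : Prop := 0 <= y <= 1.

Definition average (g : R -> R) : R := RInt g 0 1.

Definition fluct (g : R -> R) : R -> R := fun y => g y - average g.

Definition bracket (g : R -> R) : R -> R := fun y =>
  RInt (fluct g) 0 y - RInt (fun tau => RInt (fluct g) 0 tau) 0 1.

Definition bracket_iter (j : nat) (f : R -> R) : R -> R := Nat.iter j bracket f.

(* Main.v *)
(** With respect to the pairing [<u v>], the operator [bracket] is
    antisymmetric: [U = bracket u] and [V = bracket v] have mean zero and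
    periodic boundary values, so [<u V> + <U v>] is the integral of [(U V)'],
    which vanishes.  An odd power of an antisymmetric operator is antisymmetric,
    hence its quadratic form is zero.  Only the values on [0,1]
    matter, so [f] may be extended by constants to a function continuous on the
    whole line. *)

Require Import Defs.
From Stdlib Require Import Reals Lra Lia.
From Coquelicot Require Import Coquelicot.
Open Scope R_scope.

Lemma ex_RInt_continuous_everywhere (g : R -> R) (a b : R) :
  (forall x, continuous g x) -> ex_RInt g a b.
Proof. intros Hg; apply (ex_RInt_continuous g a b); intros x _; apply Hg. Qed.

Lemma continuous_fluct (g : R -> R) :
  (forall x, continuous g x) -> forall x, continuous (fluct g) x.
Proof.
  intros Hg x; apply (continuous_minus g (fun _ => average g));
    [apply Hg | apply continuous_const].
Qed.

Lemma is_derive_RInt_fluct (g : R -> R) (y : R) :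
  (forall x, continuous g x) ->
  is_derive (fun t => RInt (fluct g) 0 t) y (fluct g y).
Proof.
  intros Hg.
  apply (is_derive_RInt (fluct g) _ 0 y).
  - apply filter_forall; intros t; apply (RInt_correct (fluct g)).
    apply ex_RInt_continuous_everywhere, continuous_fluct, Hg.
  - apply continuous_fluct, Hg.
Qed.

Lemma is_derive_bracket (g : R -> R) (y : R) :
  (forall x, continuous g x) -> is_derive (bracket g) y (fluct g y).
Proof.
  intros Hg; unfold bracket.
  replace (fluct g y) with (minus (fluct g y) 0)
    by (unfold minus, plus, opp; simpl; ring).
  apply (is_derive_minus (fun t => RInt (fluct g) 0 t)).
  - now apply is_derive_RInt_fluct.
  - apply is_derive_Reals, derivable_pt_lim_const.
Qed.

Lemma continuous_bracket (g : R -> R) :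
  (forall x, continuous g x) -> forall x, continuous (bracket g) x.
Proof.
  intros Hg x; apply (ex_derive_continuous (bracket g)).
  exists (fluct g x); now apply is_derive_bracket.
Qed.

Lemma RInt_sub_const (g : R -> R) (c : R) :
  (forall x, continuous g x) ->
  RInt (fun y => g y - c) 0 1 = RInt g 0 1 - c.
Proof.
  intros Hg.
  replace (RInt g 0 1 - c) with (minus (RInt g 0 1) (scal (1 - 0) c))
    by (unfold minus, plus, opp, scal; simpl; unfold mult; simpl; ring).
  apply is_RInt_unique, (is_RInt_minus g (fun _ => c)).
  - apply (RInt_correct g); now apply ex_RInt_continuous_everywhere.
  - apply (is_RInt_const 0 1 c).
Qed.

(** The constant subtracted in [bracket] is exactly the mean of the primitive of [fluct g]. *)
Lemma average_bracket (g : R -> R) :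
  (forall x, continuous g x) -> average (bracket g) = 0.
Proof.
  intros Hg; unfold average, bracket.
  rewrite (RInt_sub_const (fun t => RInt (fluct g) 0 t)).
  - apply Rminus_diag.
  - intros x; apply (ex_derive_continuous (fun t => RInt (fluct g) 0 t)).
    exists (fluct g x); now apply is_derive_RInt_fluct.
Qed.

(** The end values differ by the integral of [fluct g] over [0,1], and a fluctuating part has mean
    zero. *)
Lemma bracket_periodic (g : R -> R) :
  (forall x, continuous g x) -> bracket g 1 = bracket g 0.
Proof.
  intros Hg; unfold bracket; rewrite (RInt_point 0 (fluct g)).
  enough (RInt (fluct g) 0 1 = 0) as -> by reflexivity.
  unfold fluct; rewrite (RInt_sub_const g _ Hg); apply Rminus_diag.
Qed.

Lemma bracket_antisym (u v : R -> R) :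
  (forall x, continuous u x) -> (forall x, continuous v x) ->
  average (fun y => u y * bracket v y) = - average (fun y => bracket u y * v y).
Proof.
  intros Hu Hv.
  pose proof (continuous_bracket u Hu) as HU.
  pose proof (continuous_bracket v Hv) as HV.
  assert (Hint : forall p : R -> R, (forall x, continuous p x) ->
      is_RInt p 0 1 (average p)).
  { intros p Hp; apply (RInt_correct p).
    now apply ex_RInt_continuous_everywhere. }
  assert (Hmul : forall p q : R -> R, (forall x, continuous p x) ->
      (forall x, continuous q x) -> forall x, continuous (fun y => p y * q y) x).
  { intros p q Hp Hq x; apply (continuous_mult p q); [apply Hp | apply Hq]. }
  (* [w] is the derivative of [bracket u * bracket v]. Its integral is computed twice: from the
     boundary values ([Hw]), and by expanding both fluctuating parts ([H6]). *)
  pose (w := fun y => fluct u y * bracket v y + bracket u y * fluct v y).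
  assert (Hw : is_RInt w 0 1
      (bracket u 1 * bracket v 1 - bracket u 0 * bracket v 0)).
  { apply (is_RInt_derive (fun y => bracket u y * bracket v y) w).
    - intros x _.
      apply (is_derive_mult (bracket u) (bracket v));
        [now apply is_derive_bracket | now apply is_derive_bracket |].
      intros; apply Rmult_comm.
    - intros x _.
      apply (continuous_plus (fun y => fluct u y * bracket v y)
        (fun y => bracket u y * fluct v y)); apply Hmul;
        auto using continuous_fluct. }
  (* Periodicity makes the boundary products cancel. *)
  rewrite (bracket_periodic u Hu), (bracket_periodic v Hv) in Hw.
  pose proof (Hint _ (Hmul _ _ Hu HV)) as H1.
  pose proof (Hint _ (Hmul _ _ HU Hv)) as H2.
  (* Expanding [fluct] leaves the corrections [average u * bracket v] and [average v * bracket u];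
     they integrate to 0 because brackets have mean zero. *)
  pose proof (is_RInt_scal _ _ _ (average u) _ (Hint _ HV)) as H3.
  pose proof (is_RInt_scal _ _ _ (average v) _ (Hint _ HU)) as H4.
  rewrite average_bracket in H3, H4 by assumption.
  pose proof (is_RInt_minus _ _ _ _ _ _ (is_RInt_plus _ _ _ _ _ _ H1 H2)
    (is_RInt_plus _ _ _ _ _ _ H3 H4)) as H5.
  assert (H6 : is_RInt w 0 1
    (minus (plus (average (fun y => u y * bracket v y))
      (average (fun y => bracket u y * v y)))
      (plus (scal (average u) 0) (scal (average v) 0)))).
  { eapply is_RInt_ext; [| exact H5].
    intros x _; unfold w, fluct, minus, plus, opp, scal; simpl.
    unfold mult; simpl; ring. }
  pose proof (is_RInt_unique _ _ _ _ Hw) as E1.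
  rewrite (is_RInt_unique _ _ _ _ H6) in E1.
  unfold minus, plus, opp, scal in E1; simpl in E1.
  unfold mult in E1; simpl in E1; lra.
Qed.

Lemma continuous_bracket_iter (n : nat) (g : R -> R) :
  (forall x, continuous g x) -> forall x, continuous (bracket_iter n g) x.
Proof.
  intros Hg; induction n as [|n IH]; [exact Hg | now apply continuous_bracket].
Qed.

(** Antisymmetry moves the outermost bracket onto the left factor [u]. Two more brackets thus
    reduce, up to sign, to the case [k] for [bracket u], so the induction must range over all
    [u]. *)
Lemma average_mul_bracket_iter_odd (k : nat) (u : R -> R) :
  (forall x, continuous u x) ->
  average (fun y => u y * bracket_iter (2 * k + 1) u y) = 0.
Proof.
  revert u; induction k as [|k IH]; intros u Hu.
  (* With both arguments equal, antisymmetry says that the average is its own negative. *)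
  - pose proof (bracket_antisym u u Hu Hu) as H.
    assert (E : average (fun y => bracket u y * u y) =
                average (fun y => u y * bracket u y)).
    { apply RInt_ext; intros; apply Rmult_comm. }
    simpl; lra.
  - assert (E : bracket_iter (2 * S k + 1) u =
                bracket (bracket_iter (2 * k + 1) (bracket u))).
    (* Of the two extra brackets, one is peeled off outside and the other is absorbed into the
       innermost argument. *)
    { replace (2 * S k + 1)%nat with (S (S (2 * k + 1))) by lia.
      unfold bracket_iter.
      now rewrite (Nat.iter_succ (S _)), Nat.iter_succ_r. }
    rewrite E, bracket_antisym.
    + rewrite IH; [apply Ropp_0 | now apply continuous_bracket].
    + exact Hu.
    + apply continuous_bracket_iter; now apply continuous_bracket.
Qed.

Lemma average_ext (g h : R -> R) :
  (forall y, unit_interval y -> g y = h y) -> average g = average h.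
Proof.
  intros E; apply RInt_ext; intros x.
  rewrite Rmin_left, Rmax_right by lra; intros Hx.
  apply E; unfold unit_interval; lra.
Qed.

(** Every integral in [bracket] stays inside [0,1] when [y] does; this allows [f] to be exchanged
    for its extension. *)
Lemma bracket_ext (g h : R -> R) :
  (forall y, unit_interval y -> g y = h y) ->
  forall y, unit_interval y -> bracket g y = bracket h y.
Proof.
  intros E.
  assert (EI : forall y, unit_interval y ->
      RInt (fluct g) 0 y = RInt (fluct h) 0 y).
  { intros y [Hy0 Hy1]; apply RInt_ext; intros x.
    rewrite Rmin_left, Rmax_right by lra; intros Hx.
    unfold fluct; rewrite (average_ext g h E).
    rewrite E; [reflexivity | unfold unit_interval; lra]. }
  intros y Hy; unfold bracket; rewrite (EI y Hy).
  apply (f_equal (Rminus _)), (average_ext _ _ EI).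
Qed.

Lemma bracket_iter_ext (n : nat) (g h : R -> R) :
  (forall y, unit_interval y -> g y = h y) ->
  forall y, unit_interval y -> bracket_iter n g y = bracket_iter n h y.
Proof.
  intros E; induction n as [|n IH]; [exact E | exact (bracket_ext _ _ IH)].
Qed.

(** The nearest-point retraction of the line onto [0,1]; [f] composed with it is the extension by
    constants. *)
Definition clamp (y : R) : R := Rmax 0 (Rmin 1 y).

Lemma clamp_unit_interval (y : R) : unit_interval (clamp y).
Proof.
  unfold unit_interval, clamp, Rmax, Rmin; repeat destruct Rle_dec; lra.
Qed.

Lemma clamp_id (y : R) : unit_interval y -> clamp y = y.
Proof.
  intros [H0 H1]; unfold clamp; rewrite Rmin_right, Rmax_right; lra.
Qed.

Lemma clamp_contraction (x y : R) : Rabs (clamp x - clamp y) <= Rabs (x - y).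
Proof.
  unfold clamp, Rmax, Rmin; repeat destruct Rle_dec;
    unfold Rabs; repeat destruct Rcase_abs; lra.
Qed.

Lemma continuous_clamp_extension (f : R -> R) :
  continuous_on unit_interval f -> forall y, continuous (fun t => f (clamp t)) y.
Proof.
  intros Hf y.
  apply (filterlim_comp _ _ _ clamp f _
    (within unit_interval (locally (clamp y)))).
  (* The same [eps] serves since [clamp] is 1-Lipschitz, and its values lie in [0,1], as the filter
     [within] demands. *)
  - intros P [eps HP]; exists eps; intros t Ht.
    apply HP; [| apply clamp_unit_interval].
    exact (Rle_lt_trans _ _ _ (clamp_contraction t y) Ht).
  - apply Hf, clamp_unit_interval.
Qed.

Theorem proposition3 (f : R -> R) (j k : nat)
  (hf : continuous_on unit_interval f)
  (hj : j = (2 * k + 1)%nat) :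
  average (fun y => f y * bracket_iter j f y) = 0.
Proof.
  subst j.
  assert (E : forall y, unit_interval y -> f y = f (clamp y)).
  { intros y Hy; now rewrite clamp_id. }
  (* The 0 on the right becomes the average for the extension, leaving only agreement of the
     integrands on [0,1]. *)
  rewrite <- (average_mul_bracket_iter_odd k (fun t => f (clamp t))).
  - apply average_ext; intros y Hy.
    now rewrite <- (E y Hy), (bracket_iter_ext _ _ _ E y Hy).
  - now apply continuous_clamp_extension.
Qed.
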